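(* Let $(X,\mathcal W,\mu)$ be a space with measured walls, with wall pseudo-metric $\mathrm{pdist}_\mu$. Assume that $X$ is $\mu$-locally finite and that all half-spaces of $X$ are quasi-convex. The following are equivalent: (1) $(X,\mathrm{pdist}_\mu)$ is $\delta$-median for some $\delta\ge 0$; (2) the medianization $\mathcal M(X)$ is at finite Hausdorff distance from (the isometrically embedded copy $\iota(X)$ of) $X$; (3) there are a median space $\mathcal M$ and an isometric embedding $\varphi:X\to\mathcal M$ such that $\mathcal M$ is within finite Hausdorff distance from $\varphi(X)$.
   Context: **Walls.** A wall of a set $X$ is a partition $w=\{h,h^c\}$ of $X$ ($h$ may be empty or all of $X$); $h,h^c$ are its half-spaces. Given a collection $\mathcal W$ of walls, $\mathcal H$ denotes the set of all half-spaces of walls in $\mathcal W$ and $\mathfrak p:\mathcal H\to\mathcal W$, $h\mapsto\{h,h^c\}$. A wall separates $A,B\subseteq X$ if $A\subseteq h$, $B\subseteq h^c$ or vice versa; $\mathcal W(A|B)$ is the set of walls in $\mathcal W$ separating $A$ and $B$, and $\mathcal W(x|y)=\mathcal W(\{x\}|\{y\})$. For $Y\subseteq X$, $\mathcal W(Y)$ is the set of walls separating two points of $Y$. A space with measured walls $(X,\mathcal W,\mu)$ is a set $X$ with a collection $\mathcal W$ of walls, a $\sigma$-algebra $\mathcal B$ on $\mathcal W$ and a measure $\mu$ on $\mathcal B$ such that $\mathcal W(x|y)\in\mathcal B$ has finite measure for all $x,y\in X$. The wall pseudo-metric is $\mathrm{pdist}_\mu(x,y)=\mu(\mathcal W(x|y))$;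 all metric notions on $X$ refer to it. (A pseudo-metric may vanish on distinct points; an isometric embedding is a distance-preserving map.) The $\sigma$-algebra and measure are pulled back to $\mathcal H$ via $\mathfrak p$: the measurable sets of $\mathcal H$ are $\mathfrak p^{-1}(E)$, $E\in\mathcal B$, with $\mu(\mathfrak p^{-1}(E))=\mu(E)$. $X$ is $\mu$-locally finite if for every $R>0$ there is $M(R)<\infty$ such that for every $x\in X$ every measurable subset of $\mathcal W(B(x,R))$ has measure at most $M(R)$, where $B(x,R)$ is the open ball. **Rough intervals.** $I_\delta(a,b)=\{t : \mathrm{pdist}(a,t)+\mathrm{pdist}(t,b)\le \mathrm{pdist}(a,b)+\delta\}$, $I(a,b)=I_0(a,b)$. A pseudo-metric space is $\delta$-median if there is $D\ge 0$ such that for any three points $x,y,z$ there is a point $m$ with $m\in I_{2\delta}(x,y)\cap I_{2\delta}(y,z)\cap I_{2\delta}(z,x)\subseteq B(m,D)$. A subset $Y$ is $(\delta,M)$-quasi-convex if $I_\delta(a,b)\subseteq\{x:\mathrm{pdist}(x,Y)\le M\}$ for all $a,b\in Y$. ''All half-spaces are quasi-convex'' means: for every $\delta\ge 0$ there is $M\ge 0$ such that all half-spaces $h\in\mathcal H$ are $(\delta,M)$-quasi-convex. **Median spaces.** A median space is a metric space in which for every $x,y,z$ the set $I(x,y)\cap I(y,z)\cap I(x,z)$ consists of exactly one point. **Medianization.** An admissible section is a set $\sigma\subseteq\mathcal H$ containing exactly one half-space of each wall and such that $h\in\sigma$, $h\subset h'$, $h'\in\mathcal H$ imply $h'\in\sigma$.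 For $x\in X$ let $\sigma_x=\{h\in\mathcal H: x\in h\}$. Fix $x_0\in X$; $\mathcal M(X)$ is the metric space obtained from the set of admissible sections $\sigma$ with $\sigma\vartriangle\sigma_{x_0}$ measurable of finite measure, with pseudo-metric $\mathrm{pdist}_\mu(\sigma,\tau)=\mu(\sigma\vartriangle\tau)$, by identifying points at distance $0$. It is independent of $x_0$ and is a median space; $\iota:X\to\mathcal M(X)$, $x\mapsto[\sigma_x]$, is an isometric embedding. *)

(* Defs.v *)
From HB Require Import structures.
From mathcomp Require Import all_boot all_order all_algebra.
From mathcomp Require Import all_classical all_reals all_analysis.

Set Implicit Arguments.
Unset Strict Implicit.
Unset Printing Implicit Defensive.

Import Order.TTheory GRing.Theory Num.Theory.

Local Open Scope classical_set_scope.
Local Open Scope ring_scope.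
Local Open Scope quotient_scope.

(* [sigma_algebra D G] does not by itself force the members of [G] to be
   subsets of [D]. *)
Definition sigma_algebra_on (T : Type) (D : set T) (G : set (set T)) :=
  sigma_algebra D G /\ forall A, G A -> A `<=` D.

(* A sigma-algebra on a subset [D] of [T] is a sigma-ring on [T]; equipping a
   copy of [T] with it makes [{measure set (sigma_on sG) -> \bar R}] the type
   of measures on [G], without requiring [D] to be inhabited (the library's
   [measurableType] is pointed). *)
Definition sigma_on (T : Type) (D : set T) (G : set (set T))
  (sG : sigma_algebra_on D G) : Type := T.

Section sigma_on_instance.
Context (T : pointedType) (D : set T) (G : set (set T)).
Variable sG : sigma_algebra_on D G.

Let G0 : G set0. Proof. by case: sG => -[]. Qed.

Let GU (F : (set T)^nat) : (forall i, G (F i)) -> G (\bigcup_i F i).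
Proof. by case: sG => -[_ _ + _]; exact. Qed.

Let GD : setD_closed G.
Proof.
have [[_ GC _] GsubD] := sG; move=> A B GA GB.
have -> : A `\` B = D `\` (\bigcup_i bigcup2 (D `\` A) B i).
  rewrite bigcup2E; apply/seteqP; split => [x [Ax nBx]|x [Dx]] /=.
    by split; [exact: GsubD GA x Ax|case=> [[]|]].
  move=> /not_orP[nDA nB]; split => //.
  by apply: contrapT => nAx; apply: nDA.
apply: (GC); apply: GU => -[|[|i]] //=; exact: GC.
Qed.

HB.instance Definition _ := Pointed.on (sigma_on sG).
HB.instance Definition _ :=
  @isSigmaRing.Build (sigma_display G) (sigma_on sG) G G0 GD GU.

End sigma_on_instance.

Section walls.
Context (X : Type).
Implicit Types (h : set X) (w : set (set X)) (W : set (set (set X))).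

Definition wall_of h : set (set X) := [set h; ~` h].

Definition is_wall w := exists h, w = wall_of h.

Definition halfspaces_of W : set (set X) := [set h | exists2 w, W w & w h].

(* A wall contains the complement of each of its half-spaces, so the
   "or vice versa" is covered by the choice of [h]. *)
Definition separating_walls W (A B : set X) : set (set (set X)) :=
  [set w | W w /\ exists h, [/\ w h, A `<=` h & B `<=` ~` h]].

(* [W(Y)] *)
Definition walls_cutting W (Y : set X) : set (set (set X)) :=
  \bigcup_(x in Y) \bigcup_(y in Y) separating_walls W [set x] [set y].

End walls.

Record measured_walls (R : realType) (X : Type) := MeasuredWalls {
  walls : set (set (set X)) ;
  wallsP : forall w, walls w -> is_wall w ;
  wsigma : set (set (set (set X))) ;
  wsigmaP : sigma_algebra_on walls wsigma ;
  wmu : {measure set (sigma_on wsigmaP) -> \bar R} ;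
  sep_measurable : forall x y,
    wsigma (separating_walls walls [set x] [set y]) ;
  sep_finite : forall x y,
    (wmu (separating_walls walls [set x] [set y]) < +oo)%E }.

Section pseudo_metric_notions.
Context (R : realType) (X : Type) (d : X -> X -> R).

Definition oball (x : X) (r : R) : set X := [set y | d x y < r].

(* [I_delta(a, b)] *)
Definition rough_interval (delta : R) (a b : X) : set X :=
  [set t | d a t + d t b <= d a b + delta].

Definition rough_median_set (delta : R) (x y z : X) : set X :=
  rough_interval (2 * delta) x y `&` rough_interval (2 * delta) y z
    `&` rough_interval (2 * delta) z x.

Definition delta_median (delta : R) :=
  exists2 D : R, 0 <= D & forall x y z, exists2 m,
    rough_median_set delta x y z m &
    rough_median_set delta x y z `<=` oball m D.

(* Equals [+oo] when [Y] is empty. *)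
Definition dist_to (Y : set X) (x : X) : \bar R :=
  ereal_inf [set (d x y)%:E | y in Y].

Definition quasi_convex (delta M : R) (Y : set X) :=
  forall a b, Y a -> Y b ->
    rough_interval delta a b `<=` [set x | (dist_to Y x <= M%:E)%E].

Definition isometric_embedding (T : metricType R) (phi : X -> T) :=
  forall x y, mdist (phi x) (phi y) = d x y.

End pseudo_metric_notions.

Section metric_notions.
Context (R : realType) (T : metricType R).

Definition median_space := forall x y z : T, exists! m,
  (rough_interval mdist 0 x y `&` rough_interval mdist 0 y z
    `&` rough_interval mdist 0 x z) m.

Definition neighborhood (r : R) (A : set T) : set T :=
  [set x | exists2 a, A a & mdist x a <= r].

Definition hausdorff_dist (A B : set T) : \bar R :=
  ereal_inf [set r%:E | r in
    [set r : R | [/\ 0 <= r, A `<=` neighborhood r B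
                   & B `<=` neighborhood r A]]].

End metric_notions.

Section measured_walls_theory.
Context (R : realType) (X : Type) (S : measured_walls R X).
Implicit Types (x y : X) (h : set X) (A B : set (set X))
  (E F : set (set (set X))).

Definition pdist x y : R :=
  fine (wmu S (separating_walls (walls S) [set x] [set y])).

Definition locally_finite := forall r : R, 0 < r -> exists M : R,
  forall x E, wsigma S E -> E `<=` walls_cutting (walls S) (oball pdist x r) ->
    (wmu S E <= M%:E)%E.

Definition halfspaces : set (set X) := halfspaces_of (walls S).

Definition halfspaces_quasi_convex := forall delta : R, 0 <= delta ->
  exists2 M : R, 0 <= M &
    forall h, halfspaces h -> quasi_convex pdist delta M h.

(* On half-spaces [wall_of] is the projection [h |-> {h, h^c}]. *)
Definition hmeasurable : set (set (set X)) :=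
  preimage_set_system halfspaces (@wall_of X) (wsigma S).

(* The projection is onto the set of walls, so that [A = p^-1(E)] determines
   [E = p(A)]: see [hmuE]. *)
Definition hmu A : \bar R := wmu S (@wall_of X @` A).

Definition admissible (s : set (set X)) := [/\ s `<=` halfspaces,
  forall w, walls S w -> exists! h, w h /\ s h &
  forall h h', s h -> h `<=` h' -> halfspaces h' -> s h'].

Definition principal x : set (set X) := [set h | halfspaces h /\ h x].

Lemma wall_ofP w h : walls S w -> w h -> w = wall_of h.
Proof.
move=> /wallsP[k ->] [|] -> //.
by rewrite /wall_of setCK setUC.
Qed.

Lemma wall_of_halfspace h : halfspaces h -> walls S (wall_of h).
Proof. by move=> [w Ww wh]; rewrite -(wall_ofP Ww wh). Qed.

Lemma image_preimage_wall E : wsigma S E ->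
  @wall_of X @` (halfspaces `&` @wall_of X @^-1` E) = E.
Proof.
move=> mE; apply/seteqP; split => [_ [h [_ Eh] <-] //|w Ew].
have Ww : walls S w by exact: (wsigmaP S).2 Ew.
have [h wE] := wallsP Ww.
have wh : w h by rewrite wE; left.
by exists h; rewrite /= -?wE; split => //; exists w.
Qed.

Lemma hmuE E : wsigma S E ->
  hmu (halfspaces `&` @wall_of X @^-1` E) = wmu S E.
Proof. by move=> mE; rewrite /hmu image_preimage_wall. Qed.

Lemma hmeasurable0 : hmeasurable set0.
Proof.
exists set0; last by rewrite preimage_set0 setI0.
by case: (wsigmaP S) => -[].
Qed.

Lemma wsigmaU E F : wsigma S E -> wsigma S F -> wsigma S (E `|` F).
Proof. exact: (@measurableU _ (sigma_on (wsigmaP S)) E F). Qed.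

Lemma wsigmaD E F : wsigma S E -> wsigma S F -> wsigma S (E `\` F).
Proof. exact: (@measurableD _ (sigma_on (wsigmaP S)) E F). Qed.

Lemma hmeasurableY A B : hmeasurable A -> hmeasurable B ->
  hmeasurable (A `+` B).
Proof.
move=> [E mE <-] [F mF <-]; exists (E `+` F).
  by apply: wsigmaU; exact: wsigmaD.
by rewrite -setIYr.
Qed.

Lemma hmu_ge0 A : (0 <= hmu A)%E.
Proof. exact: measure_ge0. Qed.

Lemma hmuY A B : hmeasurable A -> hmeasurable B ->
  (hmu (A `+` B) <= hmu A + hmu B)%E.
Proof.
move=> [E mE <-] [F mF <-]; rewrite -setIYr.
have mY : wsigma S (E `+` F) by apply: wsigmaU; exact: wsigmaD.
rewrite (hmuE mY) !hmuE//.
have mu2 := @measureU2 _ _ _ (wmu S) E F mE mF.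
apply: le_trans mu2; apply: le_measure => //; rewrite ?inE//.
  exact: wsigmaU.
by move=> w [[]|[]]; [left|right].
Qed.

Lemma principalY x y : principal x `+` principal y =
  halfspaces `&` @wall_of X @^-1` separating_walls (walls S) [set x] [set y].
Proof.
apply/seteqP; split => [h [[[Hh hx] nh]|[[Hh hy] nh]]|].
- split => //; split; first exact: wall_of_halfspace.
  exists h; split; [by left|by move=> _ ->|move=> _ -> hy].
  by apply: nh; split.
- split => //; split; first exact: wall_of_halfspace.
  exists (~` h); split; [by right|move=> _ -> hx|by move=> _ -> /=].
  by apply: nh; split.
- move=> h [Hh [_ [k [hk xk yk]]]].
  have kx := xk _ erefl; have ky := yk _ erefl.
  case: hk kx ky => [->|->] /= kx ky; [left|right].
  + by split => // -[].
  + by split => [|[]//]; split => //; exact: contrapT.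
Qed.

Lemma principal_admissible x : admissible (principal x).
Proof.
split=> [h []//|w Ww|h h' [_ hx] hh' Hh']; last by split => //; exact: hh'.
have [k wE] := wallsP Ww.
have Hw h : w h -> halfspaces h by exists w.
have [kx|nkx] := pselect (k x).
- exists k; split; first by rewrite wE; split; [left|split=> //; apply: Hw; rewrite wE; left].
  by move=> h []; rewrite wE => -[->//|->] [_ /=].
- exists (~` k); split.
    by rewrite wE; split; [right|split=> //; apply: Hw; rewrite wE; right].
  by move=> h []; rewrite wE => -[->|->//] [_ /=].
Qed.

Section medianization.
Variable x0 : X.

Definition median_sections : set (set (set X)) :=
  [set s | [/\ admissible s, hmeasurable (s `+` principal x0)
             & (hmu (s `+` principal x0) < +oo)%E]].

Definition median_section : choiceType := set_type median_sections.

Definition section_dist (s t : median_section) : R :=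
  fine (hmu (\val s `+` \val t)).

Lemma median_sectionY (s t : median_section) :
  hmeasurable (\val s `+` \val t) /\ hmu (\val s `+` \val t) \is a fin_num.
Proof.
have [_ ms fs] := set_mem (valP s); have [_ mt ft] := set_mem (valP t).
have -> : \val s `+` \val t =
    (\val s `+` principal x0) `+` (\val t `+` principal x0).
  by rewrite setYA -(setYA (\val s)) (setYC (principal x0)) !setYA
    -(setYA (\val s `+` \val t)) setYK setY0.
split; first exact: hmeasurableY.
rewrite ge0_fin_numE; last exact: hmu_ge0.
by apply: le_lt_trans (hmuY ms mt) _; exact: lte_add_pinfty.
Qed.

Lemma section_dist_ge0 s t : 0 <= section_dist s t.
Proof. by apply: fine_ge0; exact: hmu_ge0. Qed.

Lemma section_distxx s : section_dist s s = 0.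
Proof.
rewrite /section_dist setYK /hmu image_set0.
by rewrite (@measure0 _ _ _ (wmu S)).
Qed.

Lemma section_distC s t : section_dist s t = section_dist t s.
Proof. by rewrite /section_dist setYC. Qed.

Lemma section_dist_triangle t s u :
  section_dist s u <= section_dist s t + section_dist t u.
Proof.
have [mst fst'] := median_sectionY s t; have [mtu ftu] := median_sectionY t u.
have [_ fsu] := median_sectionY s u.
rewrite /section_dist -fineD// fine_le ?fin_numD ?fst'//.
apply: le_trans (hmuY mst mtu).
by rewrite setYA -(setYA (\val s)) setYK setY0.
Qed.

Definition section_equiv : rel median_section :=
  fun s t => section_dist s t == 0.

Lemma section_equiv_refl : reflexive section_equiv.
Proof. by move=> s; rewrite /section_equiv section_distxx. Qed.

Lemma section_equiv_sym : symmetric section_equiv.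
Proof. by move=> s t; rewrite /section_equiv section_distC. Qed.

Lemma section_equiv_trans : transitive section_equiv.
Proof.
move=> t s u /eqP st /eqP tu; rewrite /section_equiv eq_le section_dist_ge0.
by rewrite (le_trans (section_dist_triangle t s u))// st tu addr0.
Qed.

Canonical section_equiv_rel := EquivRel section_equiv
  section_equiv_refl section_equiv_sym section_equiv_trans.

Definition medianization : Type := {eq_quot section_equiv}.

HB.instance Definition _ : EqQuotient _ section_equiv medianization :=
  EqQuotient.on medianization.
HB.instance Definition _ := Choice.on medianization.

Definition medianization_dist (p q : medianization) : R :=
  section_dist (repr p) (repr q).

Lemma medianization_distE (s t : median_section) :
  medianization_dist (\pi_medianization s) (\pi_medianization t) =
  section_dist s t.
Proof.
have E u : section_dist (repr (\pi_medianization u)) u = 0.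
  by apply/eqP; apply/(@eqquotP _ _ medianization); rewrite reprK.
rewrite /medianization_dist; apply/eqP; rewrite eq_le; apply/andP; split.
- apply: le_trans (section_dist_triangle s _ _) _; rewrite E add0r.
  apply: le_trans (section_dist_triangle t _ _) _.
  by rewrite (section_distC t) E addr0.
- apply: le_trans (section_dist_triangle (repr (\pi_medianization s)) _ _) _.
  rewrite (section_distC s) E add0r.
  apply: le_trans (section_dist_triangle (repr (\pi_medianization t)) _ _) _.
  by rewrite E addr0.
Qed.

Lemma medianization_distxx p : medianization_dist p p = 0.
Proof. exact: section_distxx. Qed.

Lemma medianization_dist_eq0 p q : medianization_dist p q = 0 -> p = q.
Proof.
move=> /eqP pq; rewrite -[p]reprK -[q]reprK.
exact/(@eqquotP _ _ medianization).
Qed.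

Lemma medianization_distC p q : medianization_dist p q = medianization_dist q p.
Proof. exact: section_distC. Qed.

Lemma medianization_dist_triangle q p r :
  medianization_dist p r <= medianization_dist p q + medianization_dist q r.
Proof. exact: section_dist_triangle. Qed.

HB.instance Definition _ := isMetric.Build R medianization medianization_distxx
  medianization_dist_eq0 medianization_distC medianization_dist_triangle.

Lemma principal_section x : median_sections (principal x).
Proof.
split; first exact: principal_admissible.
- rewrite principalY; exists (separating_walls (walls S) [set x] [set x0]) => //.
  exact: sep_measurable.
- by rewrite principalY (hmuE (sep_measurable S x x0)); exact: sep_finite.
Qed.

Definition principal_embedding (x : X) : medianization :=
  \pi_medianization (SigSub (mem_set (principal_section x)) : median_section).

Lemma principal_embedding_isometric :
  isometric_embedding pdist principal_embedding.
Proof.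
move=> x y; rewrite [LHS]medianization_distE /section_dist /= principalY.
by rewrite (hmuE (sep_measurable S x y)).
Qed.

End medianization.
End measured_walls_theory.

(* Main.v *)
Require Import Defs.
From HB Require Import structures.
From mathcomp Require Import all_boot all_order all_algebra.
From mathcomp Require Import all_classical all_reals all_analysis.
From mathcomp Require Import lra.

Set Implicit Arguments.
Unset Strict Implicit.
Unset Printing Implicit Defensive.

Import Order.TTheory GRing.Theory Num.Theory.

Local Open Scope classical_set_scope.
Local Open Scope ring_scope.

(** The theorem compares three ways of saying that [X] coarsely has medians.

A median space [M] is rigid: in it the rough median sets are bounded. A point
[t] lying in the three intervals of [x, y, z] up to error is pushed onto the
first interval, then onto the second, then onto the third, each time by taking
a median with the two endpoints. The push moves it by a multiple of the error
and keeps it in the intervals already reached, so it ends at the median of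
[x, y, z] ([rough_median_close]). A subset of [M] that is coarsely dense then
inherits rough medians ([delta_median_of_dense]).

When [X] is coarsely dense in its medianization, the medianization itself
serves as the median space: the majority of
three admissible sections is admissible and is the unique point between each two
of them, up to measure zero ([medianization_median]). All distances here come
from the formula |A| + |B| = |A + B| + 2 |A & B| for symmetric differences,
which turns `r is between s and t' into `(r + s) & (r + t) is null'.

The heart is that rough medians make [X] coarsely dense in its medianization: a
section [s] is uniformly close to the section of some point
([section_near_point]). Choose [x] almost minimizing the distance to
[s]. If this distance exceeds the bound on the measure of the walls cutting a ball
of radius [r], then some half-space [h] of [s] is at distance at least [r] from
[x]. Move to an almost nearest point [y] of [h]. A half-space [k]
containing [y] but not [x] either contains [h], hence belongs to [s], or leaves
out some [z] in [h]; in the second case a rough median of [x, y, z] is close to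
[y] because it is close to [h], and it is close to the complement of [k], so
the wall of [k] cuts a ball of fixed radius around [y]
([near_projection_to_complement]). By local finiteness the walls of this second
kind have measure at most a constant [K] independent of [r]; crossing every
other wall on the way from [x] to [y] brings the point closer to [s]. So [y]
beats [x] by at least [r - 2 K], which contradicts the choice of [x] as soon as
[r] is larger than [2 K + 1]. *)

(** * Almost minimal values and Hausdorff distance *)

Section infima.
Context (R : realType).

Lemma near_minimizer (T : Type) (A : set T) (f : T -> R) (e : R) :
  A !=set0 -> (forall a, A a -> 0 <= f a) -> 0 < e ->
  exists2 a, A a & forall b, A b -> f a <= f b + e.
Proof.
move=> [a0 Aa0] f0 e0.
have fA : has_inf (f @` A).
  by split; [exists (f a0), a0|exists 0 => _ [a Aa <-]; exact: f0].
have [_ [a Aa <-] fa] := inf_adherent e0 fA.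
exists a => // b Ab; apply: (le_trans (ltW fa)); rewrite lerD2r.
by apply: ge_inf; [case: fA|exists b].
Qed.

Lemma dist_to_lt (X : Type) (d : X -> X -> R) (Y : set X) (x : X) (r s : R) :
  (dist_to d Y x <= r%:E)%E -> r < s -> exists2 y, Y y & d x y < s.
Proof.
move=> xY rs; have : (dist_to d Y x < s%:E)%E.
  by apply: le_lt_trans xY _; rewrite lte_fin.
by move=> /ereal_inf_lt[_ [y Yy <-]]; rewrite lte_fin; exists y.
Qed.

Lemma hausdorff_rangeP (X : Type) (M : metricType R) (phi : X -> M) :
  (hausdorff_dist (range phi) [set: M] < +oo)%E <->
  exists2 r : R, 0 <= r & forall m : M, exists x, mdist m (phi x) <= r.
Proof.
split=> [/ereal_inf_lt[_ [r [r0 _ Mr] <-] _]|[r r0 Mr]].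
  by exists r => // m; have [_ [x _ <-] mx] := Mr m I; exists x.
apply: (@le_lt_trans _ _ r%:E); last exact: ltry.
apply: ereal_inf_lbound; exists r => //; split => // m _.
  by exists m; rewrite ?mdistxx.
by have [x mx] := Mr m; exists (phi x) => //; exists x.
Qed.

End infima.

(** * Rough medians in median spaces *)

Section median_spaces.
Context (R : realType) (M : metricType R) (Mmed : median_space M).
Implicit Types (a b t x y z : M).

Local Notation interval := (rough_interval (@mdist R M) 0).

Lemma interval_sub a t b s : interval a b t -> interval a t s -> interval a b s.
Proof.
rewrite /rough_interval /= !addr0 => tab sat.
by have := metric_triangle s t b; lra.
Qed.

Lemma intervalC a b t : interval a b t -> interval b a t.
Proof.
rewrite /rough_interval /= !addr0 (metric_sym b a) (metric_sym b t).
by rewrite (metric_sym a t) addrC.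
Qed.

(** The median [s] of [a], [b] and [t] plays the part of a projection of [t] to
the interval: the distance it is moved is half the excess of [t]. *)
Lemma gate_interval a b t (e : R) : mdist a t + mdist t b <= mdist a b + 2 * e ->
  exists s, [/\ interval a b s, interval a t s, interval b t s & mdist t s <= e].
Proof.
have [s [[[sab sbt] sat] _]] := Mmed a b t => tab; exists s; split => //.
move: sab sbt sat; rewrite /rough_interval /= !addr0 => sab sbt sat.
have := metric_triangle a s b; move: sab sbt sat tab.
rewrite (metric_sym b t) (metric_sym b s) (metric_sym t s) => sab sbt sat tab tri.
lra.
Qed.

(** Three successive projections end at the median. Each projection stays in the
intervals reached before it, and the excess in the remaining ones grows by twice
the distance moved: the moves are at most [delta], [2 * delta] and
[4 * delta]. *)
Lemma rough_median_close (delta : R) x y z m t :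
  (interval x y `&` interval y z `&` interval x z) m ->
  rough_median_set (@mdist R M) delta x y z t -> mdist t m <= 7 * delta.
Proof.
move=> mm [[txy tyz] tzx].
have [t1 [t1xy t1x t1y tt1]] := gate_interval txy.
have [t2 [t2yz t2y t2z t12]] : exists s, [/\ interval y z s, interval y t1 s,
    interval z t1 s & mdist t1 s <= 2 * delta].
  apply: gate_interval; have := metric_triangle y t t1; move: tyz.
  have := metric_triangle t1 t z; rewrite /rough_interval /= (metric_sym t1 t).
  by lra.
have t2xy : interval x y t2.
  by apply: intervalC; apply: interval_sub t2y; exact: intervalC.
have [t3 [t3zx t3z t3x t23]] : exists s, [/\ interval z x s, interval z t2 s,
    interval x t2 s & mdist t2 s <= 4 * delta].
  apply: gate_interval; move: tzx; rewrite /rough_interval /=.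
  have := metric_triangle z t t2; have := metric_triangle t2 t x.
  have := metric_triangle t t1 t2; rewrite (metric_sym t2 t); lra.
have t3xy : interval x y t3 by exact: interval_sub t3x.
have t3yz : interval y z t3.
  by apply: intervalC; apply: interval_sub t3z; exact: intervalC.
have [m0 [_ m0u]] := Mmed x y z.
have <- : t3 = m.
  by rewrite -(m0u m)// -(m0u t3)//; split => //; exact: intervalC.
by have := metric_triangle t t1 t3; have := metric_triangle t1 t2 t3; lra.
Qed.

Lemma delta_median_of_dense (X : Type) (d : X -> X -> R) (phi : X -> M) (r : R) :
  isometric_embedding d phi -> 0 <= r ->
  (forall m : M, exists c, mdist m (phi c) <= r) -> delta_median d r.
Proof.
move=> iso r0 dense; exists (8 * r + 1); first by lra.
move=> x y z; have [m [mm _]] := Mmed (phi x) (phi y) (phi z).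
have [c mc] := dense m.
have near a b : interval a b m ->
    mdist a (phi c) + mdist (phi c) b <= mdist a b + 2 * r.
  rewrite /rough_interval /= addr0 => mab.
  have := metric_triangle a m (phi c); have := metric_triangle (phi c) m b.
  rewrite (metric_sym (phi c) m); lra.
have [[mxy myz] mxz] := mm.
(* The point [c] of [X] is within [r] of the median [m], so its excess is at most
   [2 * r]: this is the reason for choosing [delta := r]. *)
exists c.
  rewrite /rough_median_set /rough_interval /= -!iso.
  by split; [split|]; apply: near => //; exact: intervalC.
move=> t tm; rewrite /oball /= -iso.
have : mdist (phi t) m <= 7 * r.
  apply: rough_median_close mm _.
  by move: tm; rewrite /rough_median_set /rough_interval /= -!iso.
have := metric_triangle (phi c) m (phi t).
rewrite (metric_sym (phi c) m) (metric_sym (phi t) m); lra.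
Qed.

End median_spaces.

(** * The majority of three sets *)

Section set_identities.
Context (T : Type).
Implicit Types (A B C p q r s t : set T).

Definition majority r s t : set T := (r `&` s) `|` (s `&` t) `|` (r `&` t).

Lemma setY_path s r t : (r `+` s) `+` (r `+` t) = s `+` t.
Proof. by rewrite (setYC r s) setYA -(setYA s) setYK setY0. Qed.

(** Translating by [p] commutes with majority. With [p] the section of the base
point, this reduces measurability and finiteness to the case of sets of finite
measure. *)
Lemma majorityY p r s t :
  majority r s t `+` p = majority (r `+` p) (s `+` p) (t `+` p).
Proof.
apply/seteqP; split => h; rewrite /majority /setY /=;
  case: (pselect (p h)); case: (pselect (r h)); case: (pselect (s h));
  case: (pselect (t h)); tauto.
Qed.

Lemma majority_between r s t (m := majority r s t) :
  [/\ (m `+` r) `&` (m `+` s) = set0, (m `+` s) `&` (m `+` t) = set0 &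
      (m `+` r) `&` (m `+` t) = set0].
Proof.
by rewrite {}/m; split; apply/seteqP; split => h //; rewrite /majority /setY /=;
  case: (pselect (r h)); case: (pselect (s h)); case: (pselect (t h)); tauto.
Qed.

(** Where [q] disagrees with the majority it disagrees with two of the three sets.
Hence a section between each two of [r], [s], [t] agrees with their majority up
to a null set. *)
Lemma majorityY_sub q r s t : majority r s t `+` q `<=`
  (q `+` r) `&` (q `+` s) `|` (q `+` s) `&` (q `+` t) `|` (q `+` r) `&` (q `+` t).
Proof.
move=> h; rewrite /majority /setY /=; case: (pselect (q h));
  case: (pselect (r h)); case: (pselect (s h)); case: (pselect (t h)); tauto.
Qed.

Lemma majority_subU r s t : majority r s t `<=` r `|` s.
Proof. by move=> h; rewrite /majority /=; tauto. Qed.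

End set_identities.

(** * The measure on half-spaces *)

Section halfspace_mass.
Context (R : realType) (X : Type) (S : measured_walls R X).
Implicit Types (A B : set (set X)).

Lemma hmeasurableU A B : hmeasurable S A -> hmeasurable S B ->
  hmeasurable S (A `|` B).
Proof.
move=> [E mE <-] [F mF <-]; exists (E `|` F); first exact: wsigmaU.
by rewrite -setIUr.
Qed.

Lemma hmeasurableD A B : hmeasurable S A -> hmeasurable S B ->
  hmeasurable S (A `\` B).
Proof.
move=> [E mE <-] [F mF <-]; exists (E `\` F); first exact: wsigmaD.
by apply/seteqP; split => h; rewrite /setD /=; tauto.
Qed.

Lemma hmeasurableI A B : hmeasurable S A -> hmeasurable S B ->
  hmeasurable S (A `&` B).
Proof. by move=> mA mB; rewrite -setDD; do ! apply: hmeasurableD. Qed.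

(** Disjoint measurable sets of half-spaces come from disjoint sets of walls,
because every wall has a half-space. *)
Lemma hmuU A B : hmeasurable S A -> hmeasurable S B -> A `&` B = set0 ->
  (hmu S (A `|` B) = hmu S A + hmu S B)%E.
Proof.
move=> [E mE <-] [F mF <-] AB0.
have EF0 : E `&` F = set0.
  apply/seteqP; split=> // w [Ew Fw]; have := image_preimage_wall mE.
  move=> /seteqP[_ /(_ w Ew)] [h [Hh Eh] hw]; move/seteqP: AB0 => [+ _].
  by move=> /(_ h); apply; split; split => //=; rewrite hw.
rewrite -setIUr (hmuE (wsigmaU mE mF)) !hmuE//.
exact: (@measureU _ _ _ (wmu S)).
Qed.

Definition hfinite A := hmeasurable S A /\ (hmu S A < +oo)%E.

Definition hmass A : R := fine (hmu S A).

Lemma hmass_ge0 A : 0 <= hmass A.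
Proof. by apply: fine_ge0; exact: hmu_ge0. Qed.

Lemma hmu_hmass A : hfinite A -> hmu S A = (hmass A)%:E.
Proof. by move=> [_ fA]; rewrite fineK// ge0_fin_numE// hmu_ge0. Qed.

Lemma hfinite_sub A B : hmeasurable S A -> A `<=` B -> hfinite B -> hfinite A.
Proof.
move=> mA AB [mB fB]; split => //; apply: le_lt_trans fB.
rewrite -(setDUK AB) hmuU ?setDIK//; last exact: hmeasurableD.
by rewrite leeDl// hmu_ge0.
Qed.

Lemma hfiniteI A B : hfinite A -> hfinite B -> hfinite (A `&` B).
Proof.
move=> fA fB; apply: (@hfinite_sub _ A); [|by move=> h []|by []].
by apply: hmeasurableI; [case: fA|case: fB].
Qed.

Lemma hfiniteD A B : hfinite A -> hfinite B -> hfinite (A `\` B).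
Proof.
move=> fA fB; apply: (@hfinite_sub _ A); [|by move=> h []|by []].
by apply: hmeasurableD; [case: fA|case: fB].
Qed.

Lemma hmassU A B : hfinite A -> hfinite B -> A `&` B = set0 ->
  hmass (A `|` B) = hmass A + hmass B.
Proof.
move=> fA fB AB0; rewrite /hmass hmuU//; [|by case: fA|by case: fB].
by rewrite fineD// !hmu_hmass.
Qed.

Lemma hfiniteU A B : hfinite A -> hfinite B -> hfinite (A `|` B).
Proof.
move=> fA fB; split; first by apply: hmeasurableU; [case: fA|case: fB].
have [mD fD] := hfiniteD fB fA; have [mA ffA] := fA.
have -> : A `|` B = A `|` (B `\` A) by rewrite setUDr setDv setD0.
by rewrite hmuU ?setDIK// lte_add_pinfty.
Qed.

Lemma le_hmass A B : hfinite A -> hfinite B -> A `<=` B -> hmass A <= hmass B.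
Proof.
move=> fA fB AB; rewrite -(setDUK AB) hmassU ?setDIK//; last exact: hfiniteD.
by rewrite lerDl hmass_ge0.
Qed.

Lemma hmassDI A B : hfinite A -> hfinite B ->
  hmass A = hmass (A `\` B) + hmass (A `&` B).
Proof.
move=> fA fB; rewrite -hmassU; [by rewrite setUC setUIDK|exact: hfiniteD|exact: hfiniteI|].
by rewrite setIC -setIA setDIK setI0.
Qed.

Lemma hmassU_le A B : hfinite A -> hfinite B ->
  hmass (A `|` B) <= hmass A + hmass B.
Proof.
move=> fA fB; have -> : A `|` B = A `|` (B `\` A) by rewrite setUDr setDv setD0.
have fD := hfiniteD fB fA; rewrite hmassU ?setDIK// lerD2l.
by apply: le_hmass => //; exact: subDsetl.
Qed.

(** This identity makes [hmass (A & B)] a Gromov product when [A] and [B] are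
the symmetric differences of one section with two others. *)
Lemma hmassY A B : hfinite A -> hfinite B ->
  hmass A + hmass B = hmass (A `+` B) + 2 * hmass (A `&` B).
Proof.
move=> fA fB; rewrite (hmassDI fA fB) (hmassDI fB fA) (setIC B A).
rewrite hmassU; [lra|exact: hfiniteD|exact: hfiniteD|].
by apply/seteqP; split => h //; rewrite /setD /=; tauto.
Qed.

End halfspace_mass.

(** * The medianization is a median space *)

Section sections.
Local Open Scope quotient_scope.
Context (R : realType) (X : Type) (S : measured_walls R X) (x0 : X).
Implicit Types (x y : X) (h k : set X) (r s t : median_section S x0).

Lemma halfspaceC h : halfspaces S h -> halfspaces S (~` h).
Proof.
move=> Hh; exists (wall_of h); [exact: wall_of_halfspace|by right].
Qed.

(** Choosing one half-space of each wall is the same as choosing exactly one of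
[h] and its complement for every half-space. These are distinct since [X] is
inhabited by [x0]. *)
Lemma admissibleP (s : set (set X)) : admissible S s <->
  [/\ s `<=` halfspaces S, forall h, halfspaces S h -> (s (~` h) <-> ~ s h) &
      forall h h', s h -> h `<=` h' -> halfspaces S h' -> s h'].
Proof.
split=> -[sH sC sle]; split => //.
  move=> h Hh; have [g [[wg sg] gu]] := sC _ (wall_of_halfspace Hh).
  have hC : h <> ~` h.
    by move=> /seteqP[] /(_ x0) + /(_ x0); rewrite /setC /=; tauto.
  split=> [sc sh|nsh].
    by apply: hC; apply: etrans (esym (gu h _)) (gu (~` h) _); split=> //; [left|right].
  by case: wg => gh; rewrite gh in sg.
move=> w Ww; have [h wh] := wallsP Ww.
have Hh : halfspaces S h by exists w => //; rewrite wh; left.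
have := sC h Hh; rewrite wh; have [sh|nsh] := pselect (s h) => sCh.
  exists h; split; first by split=> //; left.
  by move=> g [[->//|->]] /sCh.
exists (~` h); split; first by split; [right|apply/sCh].
by move=> g [[->|->//]].
Qed.

Lemma section_hfinite s t : hfinite S (\val s `+` \val t).
Proof.
have [mst fst'] := median_sectionY s t; split=> //.
by rewrite -ge0_fin_numE// hmu_ge0.
Qed.

(** The failure of [r] to lie between [s] and [t] is twice the mass of the
half-spaces on which [r] disagrees with both. *)
Lemma section_dist_split r s t : section_dist s r + section_dist r t =
  section_dist s t + 2 * hmass S ((\val r `+` \val s) `&` (\val r `+` \val t)).
Proof.
rewrite (section_distC s r) [LHS]hmassY; try exact: section_hfinite.
by rewrite setY_path.
Qed.

Lemma majority_admissible (r s t : set (set X)) : admissible S r ->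
  admissible S s -> admissible S t -> admissible S (majority r s t).
Proof.
move=> /admissibleP[rH rC rle] /admissibleP[sH sC sle] /admissibleP[tH tC tle].
apply/admissibleP; split.
- by move=> h [[[/rH]|[/sH]]|[/rH]].
- move=> h Hh; have := rC h Hh; have := sC h Hh; have := tC h Hh.
  rewrite /majority /=; case: (pselect (r h)); case: (pselect (s h));
    case: (pselect (t h)); tauto.
- move=> h h' mh hh' Hh'; have := rle h h'; have := sle h h'; have := tle h h'.
  by move: mh; rewrite /majority /=; tauto.
Qed.

Lemma majority_section r s t :
  median_sections S x0 (majority (\val r) (\val s) (\val t)).
Proof.
have [ar mr fr] := set_mem (valP r); have [As ms fs] := set_mem (valP s).
have [At mt ft] := set_mem (valP t).
suff [] : hfinite S (majority (\val r) (\val s) (\val t) `+` principal S x0).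
  by split => //; exact: majority_admissible.
rewrite majorityY.
apply: hfinite_sub (@majority_subU _ _ _ _) (hfiniteU (conj mr fr) (conj ms fs)).
by do ! apply: hmeasurableU; exact: hmeasurableI.
Qed.

Lemma medianization_surj (p : medianization S x0) :
  exists s, p = \pi_(medianization S x0) s.
Proof. by exists (repr p); rewrite reprK. Qed.

Lemma medianization_median : median_space (medianization S x0).
Proof.
move=> p q o; have [r ->] := medianization_surj p.
have [s ->] := medianization_surj q; have [t ->] := medianization_surj o.
pose m : median_section S x0 := SigSub (mem_set (majority_section r s t)).
(* Betweenness in the medianization is the vanishing of the mass in
   [section_dist_split]. *)
have between u v w :
    rough_interval (@mdist R (medianization S x0)) 0 (\pi u) (\pi v) (\pi w) <->
    hmass S ((\val w `+` \val u) `&` (\val w `+` \val v)) = 0.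
  have := section_dist_split w u v.
  have := hmass_ge0 S ((\val w `+` \val u) `&` (\val w `+` \val v)).
  have E a b : mdist (\pi_(medianization S x0) a) (\pi_(medianization S x0) b) =
    section_dist a b := medianization_distE a b.
  by rewrite /rough_interval /= !E; split; lra.
have hmass0 : hmass S set0 = 0.
  by have := section_distxx r; rewrite /section_dist setYK.
exists (\pi m); split.
  have [rs st rt] := majority_between (\val r) (\val s) (\val t).
  by split; [split|]; apply/between; rewrite /= ?rs ?st ?rt.
move=> n; have [u ->] := medianization_surj n.
move=> [[/between rs /between st] /between rt].
apply: medianization_dist_eq0; rewrite medianization_distE.
apply/eqP; rewrite eq_le section_dist_ge0 andbT.
have fin a b c d := hfiniteI (section_hfinite a b) (section_hfinite c d).
apply: (le_trans (le_hmass (section_hfinite m u) _ (@majorityY_sub _ _ _ _ _))).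
  by do ! apply: hfiniteU; exact: fin.
apply: (le_trans (hmassU_le (hfiniteU (fin _ _ _ _) (fin _ _ _ _)) (fin _ _ _ _))).
have := hmassU_le (fin u r u s) (fin u s u t); lra.
Qed.

End sections.

(** Here [y] is an almost nearest point of [h] to [x], and [k] separates [y] from
both [x] and some [z] in [h]. A rough median [m] of [x, y, z] is close to [h] by
quasi-convexity, so it cannot be much closer to [x] than [y] is; lying between
[x] and [y], it is close to [y]. It also lies between [z] and [x], hence close
to the complement of [k]. Each use of quasi-convexity costs [M + 1], the choice
of [y] costs [1], and the position of [m] costs [2 * delta]. *)
Lemma near_projection_to_complement (R : realType) (X : Type) (d : X -> X -> R)
    (delta M : R) (h k : set X) (x y : X) :
  (forall a b, d a b = d b a) -> (forall b a c, d a c <= d a b + d b c) ->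
  (forall a b c, exists m, rough_median_set d delta a b c m) ->
  quasi_convex d (2 * delta) M h -> quasi_convex d (2 * delta) M (~` k) ->
  h y -> (forall z, h z -> d x y <= d x z + 1) ->
  k y -> ~ k x -> ~ h `<=` k ->
  exists2 c, ~ k c & d y c < 2 * M + 2 * delta + 3.
Proof.
move=> dC dT med qh qk hy ymin ky nkx nhk.
have [z hz nkz] : exists2 z, h z & ~ k z.
  apply: contrapT => nz; apply: nhk => z hz; apply: contrapT => nkz.
  by apply: nz; exists z.
have [m [[mxy myz] mzx]] := med x y z.
have M1 : M < M + 1 by rewrite ltrDl.
have [m' hm' mm'] := dist_to_lt (qh y z hy hz m myz) M1.
have [c nkc mc] := dist_to_lt (qk z x nkz nkx m mzx) M1.
exists c => //; have := ymin m' hm'; have := dT m x m'; have := dT m y c.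
by move: mxy; rewrite /rough_interval /= (dC m y); lra.
Qed.

(** * Sections are close to points *)

Section sections_near_points.
Context (R : realType) (X : Type) (S : measured_walls R X) (x0 : X).
Implicit Types (x y : X) (h k : set X) (s : median_section S x0).

Lemma wall_of_cutting (Y : set X) h x y : halfspaces S h -> Y x -> Y y ->
  h x -> ~ h y -> walls_cutting (walls S) Y (wall_of h).
Proof.
move=> Hh Yx Yy hx nhy; exists x => //; exists y => //.
split; first exact: wall_of_halfspace.
by exists h; split; [left|move=> _ ->|move=> _ ->].
Qed.

Lemma wall_ofC h : wall_of (~` h) = wall_of h.
Proof. by rewrite /wall_of setCK setUC. Qed.

Lemma measure_bound_ge0 (K : R) (F : set (set (set X))) :
  (forall E, wsigma S E -> E `<=` F -> (wmu S E <= K%:E)%E) -> 0 <= K.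
Proof.
move=> bound; rewrite -lee_fin; apply: le_trans (bound set0 _ _) => //.
by case: (wsigmaP S) => -[].
Qed.

(** The form in which local finiteness is applied: the bound on measurable sets of
walls is read on sets of half-spaces. *)
Lemma hmass_cutting_le (K r : R) x (A : set (set X)) :
  (forall E, wsigma S E -> E `<=` walls_cutting (walls S) (oball (pdist S) x r) ->
    (wmu S E <= K%:E)%E) ->
  hfinite S A ->
  (forall h, A h -> walls_cutting (walls S) (oball (pdist S) x r) (wall_of h)) ->
  hmass S A <= K.
Proof.
move=> bound fA Acut; rewrite -lee_fin -hmu_hmass//.
have [[E mE EA] _] := fA; rewrite -EA hmuE//; apply: bound => // w.
by rewrite -(image_preimage_wall mE) EA => -[h Ah <-]; exact: Acut.
Qed.

Definition point_section x : median_section S x0 :=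
  SigSub (mem_set (principal_section S x0 x)).

Lemma pdistE x y : pdist S x y = section_dist (point_section x) (point_section y).
Proof.
by rewrite -(principal_embedding_isometric S x0 x y) -medianization_distE.
Qed.

Lemma pdistxx x : pdist S x x = 0.
Proof. by rewrite pdistE section_distxx. Qed.

Lemma pdistC x y : pdist S x y = pdist S y x.
Proof. by rewrite !pdistE section_distC. Qed.

Lemma pdist_triangle y x z : pdist S x z <= pdist S x y + pdist S y z.
Proof. by rewrite !pdistE section_dist_triangle. Qed.

Lemma sectionC s h : halfspaces S h -> val s (~` h) <-> ~ val s h.
Proof.
have [ads _ _] := set_mem (valP s); have /(admissibleP S x0)[_ sC _] := ads.
exact: sC.
Qed.

Lemma section_halfspace s h : val s h -> halfspaces S h.
Proof. by have [[sH _ _] _ _] := set_mem (valP s); exact: sH. Qed.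

Lemma section_up s h k : val s h -> h `<=` k -> halfspaces S k -> val s k.
Proof. by have [[_ _ sle] _ _] := set_mem (valP s); exact: sle. Qed.

(** If [s] contained the empty half-space it would contain its complement too. *)
Lemma section_nonempty s h : val s h -> h !=set0.
Proof.
move=> sh; apply/set0P/negP => /eqP h0.
have Hh := section_halfspace sh.
have : val s (~` h).
  by apply: section_up sh _ (halfspaceC Hh); rewrite h0 => ?.
by move/(sectionC s Hh); exact.
Qed.

(** A wall on which [s] and [x] disagree has exactly one half-space in [s], and this
half-space misses [x]. *)
Lemma symdiff_point_sectionP s x (P : set (set X) -> Prop) :
  (forall h, val s h -> ~ h x -> P (wall_of h)) ->
  forall h, (val s `+` val (point_section x)) h -> P (wall_of h).
Proof.
move=> sP h [[sh nxh]|[[Hh hx] nsh]].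
  by apply: sP => // hx; apply: nxh; split=> //; exact: section_halfspace sh.
rewrite -wall_ofC; apply: sP; first exact/sectionC.
by move=> nhx; apply: nhx.
Qed.

(** The uniform density of [X] in its medianization, by descent from an almost
closest point. *)
Lemma section_near_point (delta : R) : locally_finite S ->
  halfspaces_quasi_convex S -> 0 <= delta ->
  (forall x y z, exists m, rough_median_set (pdist S) delta x y z m) ->
  exists2 K, 0 <= K & forall s, exists x, section_dist s (point_section x) <= K.
Proof.
move=> Slf Sqc delta0 med.
have [|M M0 qM] := Sqc (2 * delta); first by lra.
(* [rho] is the radius in [near_projection_to_complement]. *)
pose rho := 2 * M + 2 * delta + 3.
have [|K Kbound] := Slf rho; first by rewrite /rho; lra.
have K0 : 0 <= K := measure_bound_ge0 (Kbound x0).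
(* The descent gains at least [(2 * K + 2) - 2 * K = 2], more than the slack [1]
   in the choice of [x] below. *)
have [|L Lbound] := Slf (2 * K + 2); first by lra.
have L0 : 0 <= L := measure_bound_ge0 (Lbound x0).
exists L => // s.
have [x _ xmin] : exists2 x, setT x & forall y, setT y ->
    section_dist s (point_section x) <= section_dist s (point_section y) + 1.
  apply: near_minimizer => //; first by exists x0.
  by move=> x _; exact: section_dist_ge0.
exists x; apply: contrapT => /negP; rewrite -ltNge => far.
(* Otherwise every wall on which [s] and [x] disagree cuts the ball around [x],
   and their total measure is at most [L]. *)
have [h sh [nhx hfar]] : exists2 h, val s h & ~ h x /\
    forall y, h y -> 2 * K + 2 <= pdist S x y.
  apply: contrapT => nh; move: far; rewrite ltNge => /negP; apply.
  apply: hmass_cutting_le (Lbound x) (section_hfinite _ _) _.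
  apply: symdiff_point_sectionP => h sh nhx; apply: contrapT => ncut.
  apply: nh; exists h => //; split=> // y hy; rewrite leNgt; apply/negP => xy.
  apply: ncut; apply: (@wall_of_cutting _ _ y x) => //.
    exact: section_halfspace sh.
  by rewrite /oball /= pdistxx; lra.
have [y hy ymin] : exists2 y, h y & forall z, h z -> pdist S x y <= pdist S x z + 1.
  apply: near_minimizer => //; first exact: section_nonempty sh.
  by move=> z _; rewrite pdistE section_dist_ge0.
(* The walls separating [y] from both [x] and [s] are those crossed in the wrong
   direction when moving from [x] to [y]. *)
have bad : hmass S ((val (point_section y) `+` val s) `&`
    (val (point_section y) `+` val (point_section x))) <= K.
  have cut k : halfspaces S k -> k y -> ~ k x -> ~ val s k ->
      walls_cutting (walls S) (oball (pdist S) y rho) (wall_of k).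
    move=> Hk ky nkx nsk.
    have [c nkc yc] := near_projection_to_complement pdistC pdist_triangle med
      (qM h (section_halfspace sh)) (qM _ (halfspaceC Hk)) hy ymin ky nkx
      (fun hk => nsk (section_up sh hk Hk)).
    apply: (@wall_of_cutting _ _ y c) => //.
    by rewrite /oball /= pdistxx /rho; lra.
  apply: hmass_cutting_le (Kbound y) (hfiniteI _ _) _; try exact: section_hfinite.
  move=> k [ks kx].
  have [Hk [[ky [nkx nsk]]|[nky [xk sk]]]] : halfspaces S k /\
      ((k y /\ ~ k x /\ ~ val s k) \/ (~ k y /\ k x /\ val s k)).
    have := @section_halfspace s k.
    move: ks kx; rewrite /setY /= /principal /=; tauto.
  exact: cut.
  rewrite -wall_ofC; apply: cut => //; first exact: halfspaceC.
  by move/(sectionC s Hk); exact.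
have := section_dist_split (point_section y) s (point_section x).
have := xmin y I; have := hfar y hy.
by rewrite pdistC pdistE; lra.
Qed.

End sections_near_points.

Theorem theorem1p2 (R : realType) (X : Type) (S : measured_walls R X) (x0 : X)
    (Slf : locally_finite S) (Sqc : halfspaces_quasi_convex S) :
  [<-> exists2 delta : R, 0 <= delta & delta_median (pdist S) delta;
       (hausdorff_dist (range (principal_embedding S x0)) [set: medianization S x0]
          < +oo)%E;
       exists (M : metricType R) (phi : X -> M),
         [/\ median_space M, isometric_embedding (pdist S) phi &
             (hausdorff_dist (range phi) [set: M] < +oo)%E] ].
Proof.
tfae.
- move=> [delta delta0 [D _ med]].
  have [x y z|K K0 near] := section_near_point x0 Slf Sqc delta0.
    by have [m] := med x y z; exists m.
  apply/hausdorff_rangeP; exists K => // p.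
  have [s ->] := medianization_surj p; have [x sx] := near s.
  by exists x; rewrite [X in X <= _]medianization_distE.
- move=> dense; exists (medianization S x0), (principal_embedding S x0).
  split=> //; first exact: medianization_median.
  exact: principal_embedding_isometric.
- move=> [M [phi [Mmed iso /hausdorff_rangeP[r r0 dense]]]].
  by exists r => //; exact: (delta_median_of_dense Mmed iso r0 dense).
Qed.
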